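(* Every metrizable space is monotonically metacompact, and every metacompact Moore space is monotonically metacompact.
   Context: For two collections of sets $\mathcal{U}$ and $\mathcal{V}$, write $\mathcal{U} \prec \mathcal{V}$ if for each $U \in \mathcal{U}$ there is some $V \in \mathcal{V}$ with $U \subseteq V$ (this does not require $\bigcup\mathcal{U} = \bigcup\mathcal{V}$). A space $X$ is metacompact if each open cover of $X$ has a point-finite open refinement that also covers $X$. A space $X$ is monotonically metacompact (in the sense of Popvassilev) if there is a function $r$ that associates with each open cover $\mathcal{U}$ of $X$ a point-finite collection $r(\mathcal{U})$ of open sets that covers $X$ and satisfies $r(\mathcal{U}) \prec \mathcal{U}$, in such a way that if $\mathcal{U}$ and $\mathcal{V}$ are open covers of $X$ with $\mathcal{U} \prec \mathcal{V}$, then $r(\mathcal{U}) \prec r(\mathcal{V})$. A Moore space is, as usual, a regular Hausdorff space with a development. *)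

(* Defs.v *)
From mathcomp Require Import all_boot all_order all_algebra.
From mathcomp Require Import boolp classical_sets cardinality filter reals.
From mathcomp Require Import topology.
Set Implicit Arguments.
Unset Strict Implicit.
Unset Printing Implicit Defensive.

Import Order.TTheory GRing.Theory Num.Theory.
Local Open Scope classical_set_scope.
Local Open Scope ring_scope.

(* [refines U V] is the relation U ≺ V; U and V may have different unions. *)
Definition refines {T : Type} (U V : set_system T) : Prop :=
  forall A, U A -> exists2 B, V B & A `<=` B.

Definition point_finite {T : Type} (U : set_system T) : Prop :=
  forall x : T, finite_set [set A | U A /\ A x].

Definition open_cover {T : topologicalType} (U : set_system T) : Prop :=
  U `<=` open /\ cover U id = [set: T].

Definition metacompact (T : topologicalType) : Prop :=
  forall U : set_system T, open_cover U ->
    exists V : set_system T, [/\ open_cover V, point_finite V & refines V U].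

(* The operator is total on set systems; its values on set systems that are
   not open covers are unconstrained. *)
Definition monotonically_metacompact (T : topologicalType) : Prop :=
  exists r : set_system T -> set_system T,
    (forall U, open_cover U ->
       [/\ open_cover (r U), point_finite (r U) & refines (r U) U]) /\
    (forall U V, open_cover U -> open_cover V ->
       refines U V -> refines (r U) (r V)).

Definition star {T : Type} (x : T) (U : set_system T) : set T :=
  \bigcup_(A in [set A | U A /\ A x]) A.

(* The stars of x are automatically neighbourhoods of x, so the second clause
   says that they form a neighbourhood base at x. *)
Definition development {T : topologicalType} (G : nat -> set_system T) : Prop :=
  (forall n, open_cover (G n)) /\
  (forall (x : T) (A : set T), nbhs x A -> exists n, star x (G n) `<=` A).

Definition moore_space (T : topologicalType) : Prop :=
  [/\ @regular_space T, hausdorff_space T &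
      exists G : nat -> set_system T, development G].

Definition metric_on (R : realType) (T : Type) (d : T -> T -> R) : Prop :=
  [/\ forall x y, 0 <= d x y,
      forall x y, d x y = 0 <-> x = y,
      forall x y, d x y = d y x &
      forall x y z, d x z <= d x y + d y z].

(* [metricType R] bundles a metric with the uniformity and topology it
   induces; this is the corresponding property of a given topology. *)
Definition metrizable (R : realType) (T : topologicalType) : Prop :=
  exists d : T -> T -> R, metric_on d /\
    forall x : T, nbhs x =
      filter_from [set e : R | 0 < e] (fun e => [set y | d x y < e]).

(* Main.v *)
(** Let [H] be a development consisting of point-finite open covers, each
    refining the previous one, and let [r U] consist of the members of some
    [H n] that lie in an element of [U] and are not contained in a member of an
    earlier [H m] with the same property.  If the star of [x] in [H k] lies in an
    element of [U], then no member of [H n] containing [x] is selected once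
    [k < n], which gives point-finiteness; taking earliest levels gives covering
    and monotonicity.  A metacompact space with a development has such an [H],
    and a metrizable space is metacompact by M. E. Rudin's proof of Stone's
    theorem. *)
Require Import Defs.
From mathcomp Require Import all_boot all_order all_algebra.
From mathcomp Require Import lra.
From mathcomp Require Import boolp classical_sets cardinality wochoice reals.
From mathcomp Require Import filter topology.
Set Implicit Arguments.
Unset Strict Implicit.
Unset Printing Implicit Defensive.

Import Order.TTheory GRing.Theory Num.Theory.
Local Open Scope classical_set_scope.
Local Open Scope ring_scope.

(** * Refinements and open covers *)

Lemma ex_least_nat (P : nat -> Prop) :
  (exists n, P n) -> exists2 n, P n & forall m, P m -> (n <= m)%N.
Proof.
move=> [n Pn]; have exP : exists n, `[<P n>] by exists n; exact/asboolP.
case: (ex_minnP exP) => m /asboolP Pm mP.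
by exists m => // k Pk; apply: mP; exact/asboolP.
Qed.

Lemma is_subset1_finite (T : Type) (A : set T) : is_subset1 A -> finite_set A.
Proof.
move=> A1; case: (pselect (A !=set0)) => [[x Ax]|A0].
  apply: (@sub_finite_set _ _ [set x]); last exact: finite_set1.
  by move=> y Ay; exact: A1.
by apply: (@sub_finite_set _ _ set0) => // x Ax; apply: A0; exists x.
Qed.

Lemma refines_trans (T : Type) (U V W : set_system T) :
  refines U V -> refines V W -> refines U W.
Proof.
move=> UV VW A /UV[B /VW[C WC BC] AB].
by exists C => //; exact: subset_trans BC.
Qed.

Lemma ex_cover (T : topologicalType) (U : set_system T) (x : T) :
  open_cover U -> exists2 A, U A & A x.
Proof.
by move=> [_ covU]; have : cover U id x by rewrite covU.
Qed.

Lemma open_coverP (T : topologicalType) (U : set_system T) :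
  U `<=` open -> (forall x, exists2 A, U A & A x) -> open_cover U.
Proof.
by move=> oU cU; split => //; apply/seteqP; split => x // _; exact: cU.
Qed.

Definition meets (T : Type) (U V : set_system T) : set_system T :=
  [set C | exists A B, [/\ U A, V B & C = A `&` B]].

Lemma open_cover_meets (T : topologicalType) (U V : set_system T) :
  open_cover U -> open_cover V -> open_cover (meets U V).
Proof.
move=> cU cV; apply: open_coverP => [_ [A [B [UA VB ->]]]|x].
  by apply: openI; [exact: cU.1|exact: cV.1].
have [[A UA Ax] [B VB Bx]] := (ex_cover x cU, ex_cover x cV).
by exists (A `&` B) => //; exists A, B.
Qed.

Lemma meets_refinesl (T : Type) (U V : set_system T) : refines (meets U V) U.
Proof. by move=> _ [A [B [UA _ ->]]]; exists A. Qed.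

Lemma meets_refinesr (T : Type) (U V : set_system T) : refines (meets U V) V.
Proof. by move=> _ [A [B [_ VB ->]]]; exists B. Qed.

Lemma star_refines (T : Type) (x : T) (U V : set_system T) :
  refines U V -> star x U `<=` star x V.
Proof.
move=> UV y [A [UA Ax] Ay]; have [B VB AB] := UV _ UA.
by exists B; [split => //; exact: AB|exact: AB].
Qed.

(** Level [n.+1] is a point-finite refinement of the common refinement of [G n.+1] and level [n].
    Refining [G n] keeps the stars small, and refining the previous level makes the sequence
    decreasing. *)
Lemma point_finite_development (T : topologicalType) :
  metacompact T -> (exists G : nat -> set_system T, development G) ->
  exists H : nat -> set_system T,
    [/\ development H, forall n, point_finite (H n) &
        forall m n, (m <= n)%N -> refines (H n) (H m)].
Proof.
move=> mT [G [cG sG]].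
have [f fP] : exists f : set_system T -> set_system T, forall U, open_cover U ->
    [/\ open_cover (f U), point_finite (f U) & refines (f U) U].
  have /choice[f fP] : forall U : set_system T, exists V, open_cover U ->
      [/\ open_cover V, point_finite V & refines V U].
    move=> U; case: (pselect (open_cover U)) => [/mT[V VP]|nU].
      by exists V.
    (* Arbitrary value off the open covers, making the choice function total. *)
    by exists U.
  by exists f.
pose H := fix H n :=
  if n is m.+1 then f (meets (G m.+1) (H m)) else f (G 0%N).
have cH n : open_cover (H n).
  elim: n => [|n cHn] /=; first by have [] := fP _ (cG 0%N).
  by have [] := fP _ (open_cover_meets (cG n.+1) cHn).
have HS n : refines (H n.+1) (meets (G n.+1) (H n)).
  by have [] := fP _ (open_cover_meets (cG n.+1) (cH n)).
exists H; split.
- split => // x A /sG[n nA]; exists n; apply: subset_trans nA.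
  apply: star_refines; case: n => [|n]; first by have [] := fP _ (cG 0%N).
  exact: refines_trans (HS n) (@meets_refinesl _ _ _).
- move=> [|n]; first by have [] := fP _ (cG 0%N).
  by have [] := fP _ (open_cover_meets (cG n.+1) (cH n)).
- move=> m n; elim: n => [|n IHn].
    by rewrite leqn0 => /eqP -> A HA; exists A.
  rewrite leq_eqVlt => /predU1P[-> A HA|]; first by exists A.
  rewrite ltnS => /IHn; apply: refines_trans.
  exact: refines_trans (HS n) (@meets_refinesr _ _ _).
Qed.

(** * The monotone operator of a decreasing point-finite development *)

Section monotone_refinement.
Context {T : topologicalType} (H : nat -> set_system T).

Definition inside_level (U : set_system T) (n : nat) : set_system T :=
  [set A | H n A /\ exists2 B, U B & A `<=` B].

Definition monotone_refinement (U : set_system T) : set_system T :=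
  [set A | exists2 n, inside_level U n A &
     forall m B, (m < n)%N -> inside_level U m B -> ~ A `<=` B].

(* With [P B := A `<=` B] this gives monotonicity, with [P B := B x] covering. *)
Lemma monotone_refinement_earliest (U : set_system T) (P : set_system T) n A :
  (forall A B, P A -> A `<=` B -> P B) -> inside_level U n A -> P A ->
  exists2 B, monotone_refinement U B & P B.
Proof.
move=> Pup UnA PA.
have [|k [B UkB PB] kmin] :=
    @ex_least_nat (fun n => exists2 B, inside_level U n B & P B).
  by exists n, A.
(* A set [C] of an earlier level containing [B] would inherit [P], against the minimality of [k]. *)
exists B => //; exists k => // m C mk UmC BC.
have := kmin m (ex_intro2 _ _ C UmC (Pup _ _ PB BC)).
by rewrite leqNgt mk.
Qed.

Hypothesis devH : development H.
Hypothesis finH : forall n, point_finite (H n).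
Hypothesis decH : forall m n, (m <= n)%N -> refines (H n) (H m).

Lemma ex_star_inside (U : set_system T) (x : T) : open_cover U ->
  exists k, exists2 B, U B & star x (H k) `<=` B.
Proof.
move=> cU; have [B UB Bx] := ex_cover x cU.
have /devH.2[k kB] : nbhs x B by apply: open_nbhs_nbhs; split => //; exact: cU.1.
by exists k, B.
Qed.

Lemma star_inside (U : set_system T) (x : T) (B : set T) k A :
  U B -> star x (H k) `<=` B -> H k A -> A x -> inside_level U k A.
Proof.
move=> UB kB HA Ax; split => //; exists B => //.
by apply: subset_trans kB => y Ay; exists A.
Qed.

Lemma monotone_refinement_cover (U : set_system T) :
  open_cover U -> open_cover (monotone_refinement U).
Proof.
move=> cU; apply: open_coverP => [A [n [HA _] _]|x].
  exact: (devH.1 n).1 _ HA.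
have [k [B UB kB]] := ex_star_inside x cU.
have [A HA Ax] := ex_cover x (devH.1 k).
apply: (monotone_refinement_earliest _ (star_inside UB kB HA Ax) Ax).
by move=> C D Cx; exact.
Qed.

Lemma monotone_refinement_point_finite (U : set_system T) :
  open_cover U -> point_finite (monotone_refinement U).
Proof.
move=> cU x; have [k [B UB kB]] := ex_star_inside x cU.
apply: (@sub_finite_set _ _
  (\bigcup_(n in `I_k.+1) [set A | H n A /\ A x])); last first.
  by apply: bigcup_finite => [|n _]; [exact: finite_II|exact: finH].
move=> A [[n [HA _] nA] Ax]; exists n => //=; rewrite ltnS leqNgt.
(* Beyond level [k], [A] lies in some [C] of [H k]; as [C] contains [x], it lies in the star and
   hence in [B], so [A] could not have been selected. *)
apply/negP => kn; have [C HC AC] := decH (ltnW kn) HA.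
exact: nA kn (star_inside UB kB HC (AC _ Ax)) AC.
Qed.

Lemma monotone_refinement_refines (U : set_system T) :
  refines (monotone_refinement U) U.
Proof. by move=> A [n [_ ?]]. Qed.

(** A candidate for [U] at level [n] is a candidate for [V] at the same level, so it lies in a
    candidate for [V] of earliest level, which is selected. *)
Lemma monotone_refinement_monotone (U V : set_system T) :
  refines U V -> refines (monotone_refinement U) (monotone_refinement V).
Proof.
move=> UV A [n [HA [B UB AB]] _].
apply: (@monotone_refinement_earliest _ (fun B => A `<=` B) n A) => //.
  by move=> C D AC; exact: subset_trans.
split => //; have [C VC BC] := UV _ UB.
by exists C => //; exact: subset_trans BC.
Qed.

End monotone_refinement.

Lemma metacompact_development_monotonically_metacompact (T : topologicalType) :
  metacompact T -> (exists G : nat -> set_system T, development G) ->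
  monotonically_metacompact T.
Proof.
move=> mT /(point_finite_development mT)[H [devH finH decH]].
exists (monotone_refinement H); split => [U cU|U V _ _]; last first.
  exact: monotone_refinement_monotone.
split; first exact: monotone_refinement_cover.
  exact: monotone_refinement_point_finite.
exact: monotone_refinement_refines.
Qed.

(** * Metrizable spaces: balls and the development they form *)

Section metrizable.
Context {R : realType} {T : topologicalType} (d : T -> T -> R).
Hypothesis metric_d : metric_on d.
Hypothesis nbhs_d : forall x : T,
  nbhs x = filter_from [set e : R | 0 < e] (fun e => [set y | d x y < e]).

Let dball (x : T) (e : R) : set T := [set y | d x y < e].
Let radius (n : nat) : R := n.+1%:R^-1.

Let d_sym x y : d x y = d y x. Proof. by have [] := metric_d. Qed.

Let d_triangle x y z : d x z <= d x y + d y z.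
Proof. by have [] := metric_d. Qed.

Let dball_center x e : 0 < e -> dball x e x.
Proof. by have [_ /(_ x x)[_ d0] _ _] := metric_d; rewrite /dball /= d0. Qed.

Let radius_gt0 n : 0 < radius n.
Proof. by rewrite invr_gt0. Qed.

Let radius_le m n : (m <= n)%N -> radius n <= radius m.
Proof. by move=> mn; rewrite lef_pV2 ?posrE// ler_nat. Qed.

Let ex_radius (e : R) : 0 < e -> exists n, radius n < e.
Proof.
move=> e0; exists (Num.bound e^-1).
rewrite -[ltRHS]invrK ltf_pV2 ?posrE ?invr_gt0//.
apply: lt_trans (archi_boundP _) _; first by rewrite invr_ge0 ltW.
by rewrite ltr_nat.
Qed.

Let open_dball x e : open (dball x e).
Proof.
rewrite openE => y xy; rewrite /interior nbhs_d.
exists (e - d x y); first by rewrite /= subr_gt0.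
move=> z /= yz; apply: le_lt_trans (d_triangle x y z) _; lra.
Qed.

(** The factor [c] leaves room for triangle inequalities: it is 2 for stars, 3 for the shrinkings
    and 1 for point-finiteness. *)
Let ex_dball_sub (x : T) (A : set T) (c : R) : 0 < c -> open A -> A x ->
  exists n, dball x (c * radius n) `<=` A.
Proof.
move=> c0 oA Ax; have : nbhs x A by exact: open_nbhs_nbhs.
rewrite nbhs_d => -[e /= e0 eA].
have [|n ne] := @ex_radius (e / c); first exact: divr_gt0.
exists n; apply: subset_trans eA => y /lt_trans; apply.
by rewrite mulrC -ltr_pdivlMr.
Qed.

Lemma metric_development : exists G : nat -> set_system T, development G.
Proof.
exists (fun n => [set dball x (radius n) | x in [set: T]]); split => [n|x A].
  apply: open_coverP => [_ [x _ <-]|x]; first exact: open_dball.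
  by exists (dball x (radius n)); [exists x|exact: dball_center].
rewrite nbhsE => -[B [oB Bx] BA].
have [n nB] := ex_dball_sub (ltr0Sn _ 1) oB Bx.
exists n => z [_ [[y _ <-] yx] yz]; apply/BA/nB.
rewrite /dball/= in yx yz *; apply: le_lt_trans (d_triangle x y z) _.
rewrite (d_sym x y); lra.
Qed.

(** * Rudin's construction over a well-ordered cover *)

Section stone.
Variable U : set_system T.
Hypothesis cU : open_cover U.
Variable le : rel (set T).
Hypothesis le_well_order : well_order le.

Let least (x : T) (A : set T) :=
  [/\ U A, A x & forall B, U B -> B x -> le A B].

Let ex_least x : exists A, least x A.
Proof.
have [A UA Ax] := ex_cover x cU.
have [|B [[/asboolP[UB Bx] lB] _]] :=
    le_well_order (A := fun A : set T => `[<U A /\ A x>]).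
  by exists A; exact/asboolP.
by exists B; split => // C UC Cx; apply: lB; exact/asboolP.
Qed.

(* The [n]-th shrinking of [A] in Rudin's construction, where [E] is the union
   of the shrinkings of all members of [U] at the stages before [n]. *)
Let shrink (E : set T) (n : nat) (A : set T) : set T :=
  \bigcup_(y in [set y | [/\ least y A, ~ E y &
                             dball y (3 * radius n) `<=` A]])
     dball y (radius n).

Let used := fix used n : set T :=
  if n is m.+1 then used m `|` \bigcup_(A in U) shrink (used m) m A else set0.

Let used_le m n : (m <= n)%N -> used m `<=` used n.
Proof.
elim: n => [|n IHn]; first by rewrite leqn0 => /eqP ->.
rewrite leq_eqVlt ltnS => /predU1P[-> //|/IHn mn].
by apply: subset_trans mn _ => x; left.
Qed.

Let usedP n x : used n x -> exists m A, U A /\ shrink (used m) m A x.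
Proof.
elim: n => [//|n IHn] /= [/IHn//|[A UA nA]].
by exists n, A.
Qed.

Let open_shrink E n A : open (shrink E n A).
Proof. by apply: bigcup_open => y _; exact: open_dball. Qed.

Let shrink_sub E n A : shrink E n A `<=` A.
Proof.
move=> x [y [_ _ yA] yx]; apply: yA; rewrite /dball/= in yx *.
have := radius_gt0 n; lra.
Qed.

(** The centres [y] and [z] of two balls through [x] are less than [2 * radius n] apart. If [A]
    comes first, the tripled ball about [y] puts [z] in [A], while [B] is the first member
    containing [z]. *)
Let shrink_inj E n A B x : shrink E n A x -> shrink E n B x -> A = B.
Proof.
have le_chain : wo_chain le predT by exact: withinW.
have le_total : total le by move=> C D; exact: (wo_chainW le_chain).
have le_anti : antisymmetric le.
  by move=> C D; exact: (wo_chain_antisymmetric le_chain).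
wlog leAB : A B / le A B.
  by move=> IH Ax Bx; case/orP: (le_total A B) => /IH -> //.
move=> [y [[UA Ay ly] _ yA] yx] [z [[UB Bz lz] _ _] zx].
apply: le_anti; rewrite leAB /=; apply: lz => //; apply: yA.
rewrite /dball/= in yx zx *; apply: le_lt_trans (d_triangle y x z) _.
have := radius_gt0 n; rewrite (d_sym x z); lra.
Qed.

Lemma metric_point_finite_refinement :
  exists V : set_system T, [/\ open_cover V, point_finite V & refines V U].
Proof.
exists [set shrink (used n) n A | n in [set: nat] & A in U].
have cov x : exists n A, U A /\ shrink (used n) n A x.
  have [A xA] := ex_least x; have [UA Ax _] := xA.
  have [n nA] := ex_dball_sub (ltr0Sn _ 2) (cU.1 _ UA) Ax.
  (* A point not covered before stage [n] is itself an admissible centre. *)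
  case: (pselect (used n x)) => [/usedP //|nx].
  by exists n, A; split => //; exists x => //; exact: dball_center.
split.
- apply: open_coverP => [_ [n _ [A UA <-]]|x]; first exact: open_shrink.
  have [n [A [UA Ax]]] := cov x.
  by exists (shrink (used n) n A) => //; exists n => //; exists A.
- move=> x; have [n [A [UA Ax]]] := cov x.
  have [j jA] := ex_dball_sub ltr01 (open_shrink _ _ _) Ax.
  (* Only stages [i] with [i <= n] or [i < j] can contribute, each at most one set through [x] by
     [shrink_inj]. *)
  apply: (@sub_finite_set _ _ (\bigcup_(i in `I_(maxn n.+1 j))
    [set C | (exists2 B, U B & C = shrink (used i) i B) /\ C x])); last first.
    apply: bigcup_finite => [|i _]; first exact: finite_II.
    apply: is_subset1_finite => _ _ [[B _ ->] Bx] [[C _ ->] Cx].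
    by rewrite (shrink_inj Bx Cx).
  move=> _ [[i _ [B UB <-]] Bx]; exists i => /=; last by split => //; exists B.
  rewrite ltnNge geq_max; apply/negP => /andP[ni ji].
  (* the centre of the ball of [shrink i B] around [x] would be within
     [radius j] of [x], hence in [shrink n A], used before stage [i] *)
  have [y [_ nEy _] yx] := Bx; apply/nEy/(used_le ni); right; exists A => //.
  apply: jA; rewrite /dball/= in yx *; rewrite d_sym mul1r.
  exact: lt_le_trans yx (radius_le ji).
- by move=> _ [n _ [A UA <-]]; exists A => //; exact: shrink_sub.
Qed.

End stone.

Lemma metric_metacompact : metacompact T.
Proof.
move=> U cU; have [le le_wo] := well_ordering_principle (set T).
exact: metric_point_finite_refinement cU le le_wo.
Qed.

End metrizable.

Theorem theorem1p1 :
  (forall (R : realType) (T : topologicalType),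
     metrizable R T -> monotonically_metacompact T) /\
  (forall T : topologicalType,
     metacompact T -> moore_space T -> monotonically_metacompact T).
Proof.
split => [R T [d [metric_d nbhs_d]]|T mT [_ _ devT]].
  apply: metacompact_development_monotonically_metacompact.
    exact: metric_metacompact metric_d nbhs_d.
  exact: metric_development metric_d nbhs_d.
exact: metacompact_development_monotonically_metacompact.
Qed.
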